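(* There exists a Hausdorff topological space that has a bounded complete dcpo model and is not a k-space.
   Context: A nonempty subset $D$ of a poset is directed if any two elements of $D$ have an upper bound in $D$. A dcpo is a poset in which every directed subset has a supremum. A poset is bounded complete if every nonempty upper-bounded subset has a supremum. The Scott topology $\Sigma(P)$ on a poset $P$ consists of the upper sets $U$ such that whenever $D\subseteq P$ is directed, $\bigvee D$ exists and $\bigvee D\in U$, then $D\cap U\ne\varnothing$. $\operatorname{Max}(P)$ is the set of maximal elements of $P$. A dcpo model of a space $X$ is a dcpo $P$ such that $\operatorname{Max}(P)$, with the subspace topology inherited from $\Sigma(P)$, is homeomorphic to $X$; it is a bounded complete dcpo model if $P$ is moreover bounded complete. A Hausdorff space $X$ is a k-space if a subset $A\subseteq X$ is closed whenever $A\cap K$ is closed in $K$ for every compact $K\subseteq X$. *)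

(* Defs.v *)
From HB Require Import structures.
From mathcomp Require Import all_boot all_order.
From mathcomp Require Import all_classical all_reals all_analysis.

Set Implicit Arguments.
Unset Strict Implicit.
Unset Printing Implicit Defensive.

Local Open Scope classical_set_scope.
Local Open Scope order_scope.

Section Posets.
Context {d : Order.disp_t} {P : porderType d}.

Definition directed (D : set P) : Prop :=
  D !=set0 /\
  forall x y, D x -> D y -> exists z, [/\ D z, x <= z & y <= z].

Definition scott_open (U : set P) : Prop :=
  (forall x y, U x -> x <= y -> U y) /\
  (forall (D : set P) (s : P),
     directed D -> supremums D s -> U s -> D `&` U !=set0).

Lemma scott_openT : scott_open setT.
Proof. by split=> // D s [[x Dx] _] _ _; exists x. Qed.

Lemma scott_openI : setI_closed scott_open.
Proof.
move=> U V [Uup Usc] [Vup Vsc]; split=> [x y [Ux Vx] xy|D s Ddir Ds [Us Vs]].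
  by split; [exact: Uup xy|exact: Vup xy].
have [x [Dx Ux]] := Usc D s Ddir Ds Us.
have [y [Dy Vy]] := Vsc D s Ddir Ds Vs.
have [z [Dz xz yz]] := Ddir.2 x y Dx Dy.
by exists z; split=> //; split; [exact: Uup xz|exact: Vup yz].
Qed.

Lemma scott_open_bigcup (I : Type) (f : I -> set P) :
  (forall i, scott_open (f i)) -> scott_open (\bigcup_i f i).
Proof.
move=> fo; split=> [x y [i _ fx] xy|D s Ddir Ds [i _ fs]].
  by exists i => //; exact: (fo i).1 xy.
by have [x [Dx fx]] := (fo i).2 D s Ddir Ds fs; exists x; split=> //; exists i.
Qed.

End Posets.

Definition is_dcpo d (P : porderType d) : Prop :=
  forall D : set P, directed D -> exists s, supremums D s.

(* [has_sup A] only says that A is nonempty and bounded above. *)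
Definition bounded_complete d (P : porderType d) : Prop :=
  forall A : set P, has_sup A -> exists s, supremums A s.

(* P with its Scott topology; an alias, because P may already carry another
   topology. *)
Definition scott d (P : porderType d) : Type := P.

HB.instance Definition _ d (P : porderType d) := Order.POrder.on (scott P).
HB.instance Definition _ d (P : porderType d) :=
  isOpenTopological.Build (scott P)
    (@scott_openT d P) (@scott_openI d P) (@scott_open_bigcup d P).

Definition Max d (P : porderType d) : set (scott P) :=
  [set m | forall x : scott P, m <= x -> x = m].
Arguments Max {d} P _.

Definition homeomorphic (X Y : topologicalType) : Prop :=
  exists (f : X -> Y) (g : Y -> X),
    [/\ continuous f, continuous g, cancel f g & cancel g f].

(* [set_type A] carries the subspace topology of A. *)
Definition dcpo_model d (P : porderType d) (X : topologicalType) : Prop :=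
  is_dcpo P /\ homeomorphic (set_type (Max P)) X.

Definition bounded_complete_dcpo_model d (P : porderType d)
    (X : topologicalType) : Prop :=
  dcpo_model P X /\ bounded_complete P.

(* Only meant for Hausdorff X; closedness of A `&` K is taken in the subspace
   [set_type K]. *)
Definition k_space (X : topologicalType) : Prop :=
  forall A : set X,
    (forall K : set X, compact K ->
       closed ((set_val : set_type K -> X) @^-1` (A `&` K))) ->
    closed A.

(* Main.v *)
Require Import Defs.
From HB Require Import structures.
From mathcomp Require Import all_boot all_order.
From mathcomp Require Import all_classical all_reals all_analysis.
From mathcomp Require Import wochoice.

(* Put a top element on the well-ordered chain omega_1 and one further maximal
   element ("tooth") above each of its points. In this poset every set without
   maximal elements has a supremum, because omega_1 is well-ordered, so the
   poset is a bounded complete dcpo. Its maximal points are the top and the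
   teeth; the teeth are isolated, and the basic neighbourhoods of the top
   contain the teeth above some countable ordinal. Countable sets of teeth are
   bounded in omega_1, hence closed, so compact sets are finite; but the set of
   all teeth, which meets each of them in a closed set, is not closed, since the
   chain converges to the top. *)

Set Implicit Arguments.
Unset Strict Implicit.
Unset Printing Implicit Defensive.

Import Order.TTheory.
Local Open Scope classical_set_scope.
Local Open Scope order_scope.

(** * Well-orders and the ordinal omega_1 *)

Definition has_minima d (W : orderType d) : Prop :=
  forall S : set W, S !=set0 -> exists2 m, S m & forall w, S w -> m <= w.

(** Together with [has_minima], this is all that the comb needs of omega_1. Since the bound is
    strict, taking [C] empty or a singleton shows that [W] is inhabited and has no greatest
    element. *)
Definition countably_bounded d (W : orderType d) : Prop :=
  forall C : set W, countable C -> exists b, forall w, C w -> w < b.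

Lemma well_order_total_order (T : eqType) (R : rel T) :
  well_order R -> total_order R.
Proof.
move=> /[dup] wo /(withinW (A := predT)) woT.
have tot x y : R x y || R y x by exact: wo_chainW woT _ _ _ _.
have anti : antisymmetric R.
  by move=> x y; exact: wo_chain_antisymmetric woT _ _ _ _.
have refl x : R x x by have := tot x x; rewrite orbb.
split=> //; split=> //; split=> // y x z xy yz.
(* Transitivity comes from the least of the three points: if it is [y] or [z], antisymmetry
   identifies it with the point before it. *)
have [|m [[]]] := wo [pred t | t \in [:: x; y; z]].
  by exists x; rewrite !inE eqxx.
rewrite !inE => /or3P[]/eqP-> mle _.
- by apply: mle; rewrite !inE eqxx !orbT.
- rewrite (anti x y) ?xy//; apply: mle.
  by rewrite !inE eqxx.
- by rewrite -(anti y z)// yz; apply: mle; rewrite !inE eqxx orbT.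
Qed.

Lemma uncountable_set_nat : ~ countable [set: set nat].
Proof.
move=> /countable_injP[f finj].
(* Cantor's diagonal set: the codes of the sets that miss their own code. *)
pose D : set nat := [set n | exists2 A, f A = n & ~ A n].
have nD : ~ D (f D).
  move=> [A /finj]; rewrite !inE => /(_ I I) AD nA.
  by apply: (nA); rewrite AD; exists A => //; rewrite AD.
by apply: (nD); exists D.
Qed.

Definition set_nat_le : rel (set nat) :=
  sval (well_ordering_principle (set nat)).

Lemma set_nat_le_wo : well_order set_nat_le.
Proof. exact: svalP. Qed.

(** Elements with only countably many predecessors in a well-order of the uncountable power set of
    the naturals form an initial segment of type omega_1. *)
Definition omega1 : Type :=
  {x : set nat | `[< countable [set y | set_nat_le y x] >]}.

HB.instance Definition _ := Choice.on omega1.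

Definition omega1_le (x y : omega1) : bool := set_nat_le (val x) (val y).

Lemma omega1_le_refl : reflexive omega1_le.
Proof.
have [[[refl _] _] _] := well_order_total_order set_nat_le_wo.
by move=> x; exact: refl.
Qed.

Lemma omega1_le_anti : antisymmetric omega1_le.
Proof.
have [[_ anti] _] := well_order_total_order set_nat_le_wo.
by move=> x y /anti/val_inj.
Qed.

Lemma omega1_le_trans : transitive omega1_le.
Proof.
have [[[_ trans] _] _] := well_order_total_order set_nat_le_wo.
by move=> x y z; exact: trans.
Qed.

Lemma omega1_le_total : total omega1_le.
Proof.
have [_ tot] := well_order_total_order set_nat_le_wo.
by move=> x y; exact: tot.
Qed.

Fact omega1_display : Order.disp_t. Proof. exact: (Order.Disp tt tt). Qed.

HB.instance Definition _ := Order.Le_isPOrder.Build omega1_display omega1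
  omega1_le_refl omega1_le_anti omega1_le_trans.
HB.instance Definition _ :=
  Order.POrder_isTotal.Build omega1_display omega1 omega1_le_total.

Lemma omega1_has_minima : has_minima omega1.
Proof.
move=> S [x0 Sx0].
have [|m [[]]] := set_nat_le_wo (A := mem (val @` S)).
  by exists (val x0); rewrite inE; exists x0.
rewrite inE => -[x Sx <-] mle _; exists x => // y Sy.
by apply: mle; rewrite inE; exists y.
Qed.

(** Otherwise some set of naturals lies outside [omega1]. Everything strictly below the least such
    [m] is in [omega1], so [m] has countably many predecessors and belongs to [omega1] itself. *)
Lemma uncountable_omega1 : ~ countable [set: omega1].
Proof.
move=> ctbl; have ctblI : countable [set val x | x in [set: omega1]].
  exact: sub_countable (card_image_le _ _) ctbl.
have [|m [[mI mle] _]] :=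
    set_nat_le_wo (A := mem (~` [set val x | x in [set: omega1]])).
  apply: contrapT => /forallNP noz; apply: uncountable_set_nat.
  apply: sub_countable ctblI; apply: subset_card_le => z _.
  by have := noz z; rewrite inE => /contrapT.
rewrite inE in mI; apply: mI.
have mctbl : countable [set y | set_nat_le y m].
  apply: (@sub_countable _ _ _ ([set m] `|` [set val x | x in [set: omega1]])).
    apply: subset_card_le => y /= ym; apply: contrapT => /not_orP[yneqm yI].
    apply: yneqm; have [[_ anti] _] := well_order_total_order set_nat_le_wo.
    by apply: anti; rewrite ym mle// inE.
  rewrite -bigcup2E; apply: bigcup_countable => [|[|[|i]] _] //=.
by exists (exist _ m (asboolT mctbl)).
Qed.

(** The initial segments below the points of a countable set without strict bound would cover
    [omega1] by countably many countable sets. *)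
Lemma omega1_countably_bounded : countably_bounded omega1.
Proof.
move=> C Cc; apply: contrapT => /forallNP nob; apply: uncountable_omega1.
apply: (@sub_countable _ _ _ (\bigcup_(x in C) [set y | y <= x])).
  apply: subset_card_le => y _.
  have /existsNP[x /not_implyP[Cx /negP]] := nob y.
  by rewrite -leNgt; exists x.
apply: bigcup_countable => // x _.
have /asboolP/countable_injP[f finj] := valP x.
apply/countable_injP; exists (f \o val) => y z; rewrite !inE => yx zx fyz.
by apply/val_inj/finj; rewrite ?inE.
Qed.

(* [None] is the top of the chain; the boolean tells a tooth ([true]) from the
   point of the chain below it ([false]). *)
Definition comb d (W : orderType d) : Type := option (W * bool).

HB.instance Definition _ d (W : orderType d) := Choice.on (comb W).

(** * The comb: completeness and Scott-open sets *)

Section Comb.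
Context {d : Order.disp_t} {W : orderType d}.
Implicit Types (v w b : W) (x y z : comb W) (D : set (comb W)).

Definition stem w : comb W := Some (w, false).
Definition tooth w : comb W := Some (w, true).
Definition tip : comb W := None.

Definition comb_le x y : bool :=
  match x, y with
  | Some (v, false), Some (w, _) => v <= w
  | Some (_, false), None => true
  | _, _ => x == y
  end.

Lemma comb_le_refl : reflexive comb_le.
Proof. by move=> [[w []]|] /=. Qed.

Lemma comb_le_anti : antisymmetric comb_le.
Proof.
move=> [[v []]|] [[w []]|] //= /andP[].
- by move=> /eqP.
- by move=> /eqP.
- by move=> _ /eqP.
- by move=> vw wv; rewrite (@le_anti _ _ v w) ?vw.
Qed.

Lemma comb_le_trans : transitive comb_le.
Proof.
move=> y [[v []]|] z /=; [by move=> /eqP<-| |by move=> /eqP<-].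
by case: y => [[w []]|] /=; case: z => [[u c]|] //=;
  [move=> vw /eqP[<-]|exact: le_trans].
Qed.

HB.instance Definition _ := Order.Le_isPOrder.Build d (comb W)
  comb_le_refl comb_le_anti comb_le_trans.

Lemma le_stem v w : (stem v <= stem w) = (v <= w). Proof. by []. Qed.

Definition is_stem x : bool := if x is Some (_, false) then true else false.

Lemma nstem_maximal x y : ~~ is_stem x -> x <= y -> y = x.
Proof. by case: x => [[v []]|] //= _ /eqP. Qed.

Lemma is_stemP x : reflect (exists w, x = stem w) (is_stem x).
Proof. by case: x => [[v []]|]; constructor; [case|exists v|case]. Qed.

(** The last hypothesis is what directed and bounded sets share: a maximal element of [D] is its
    greatest. If there is none, [D] lies in the stem, and its supremum is its least bound there, or
    [tip] when the stem has no bound. *)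
Lemma comb_supremum D :
    has_minima W -> D !=set0 -> (forall x, D x -> ~~ is_stem x -> ubound D x) ->
  exists s, supremums D s.
Proof.
move=> wo [x0 Dx0] Dmax.
have [[x Dx nx]|/forall2NP Dstem] := pselect (exists2 x, D x & ~~ is_stem x).
  by exists x; split=> [|y /(_ _ Dx)//]; exact: Dmax.
have {Dmax}Dstem x : D x -> exists w, x = stem w.
  by move=> Dx; have [//|/negP/negPn/is_stemP] := Dstem x.
pose S : set W := [set b | forall w, D (stem w) -> w <= b].
have ubS b : S b <-> ubound D (stem b).
  by split=> [Sb x /[dup]/Dstem[w ->]/Sb//|ub w /ub].
(* If a tooth bounds [D], so does the stem point at its foot. *)
have ub0 y : ubound D y -> y <> tip -> exists2 b, S b & stem b <= y.
  case: y => [[b c]|]// ub _; exists b; last exact: lexx b.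
  by move=> w /ub.
have [[b Sb]|noS] := pselect (S !=set0).
  have [|m Sm mle] := wo S; first by exists b.
  exists (stem m); split; first exact/ubS.
  move=> y uby; have [->//|/eqP/(ub0 _ uby)[c Sc]] := eqVneq y tip.
  by apply: le_trans; rewrite le_stem; exact: mle.
exists tip; split=> [x /Dstem[w ->]//|y uby].
have [->//|/eqP/(ub0 _ uby)[c Sc _]] := eqVneq y tip.
by case: noS; exists c.
Qed.

Lemma comb_dcpo : has_minima W -> is_dcpo (comb W).
Proof.
move=> wo D [D0 dir]; apply: comb_supremum => // x Dx nx y Dy.
by have [z [_ /(nstem_maximal nx)->]] := dir x y Dx Dy.
Qed.

Lemma comb_bounded_complete : has_minima W -> bounded_complete (comb W).
Proof.
move=> wo D [D0 [u ub]]; apply: comb_supremum => // x Dx nx.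
by rewrite -(nstem_maximal nx (ub _ Dx)).
Qed.

Definition tail b : set (comb W) :=
  [set x | match x with Some (w, _) => b < w | None => True end].

(* A directed set with supremum [tip] consists of points of the stem, and
   [stem b] does not bound it. *)
Lemma scott_open_tail b : scott_open (tail b).
Proof.
split=> [[[v []]|] y /= bv|].
- by move=> /eqP <-.
- by case: y => [[w c]|] //= vw; exact: lt_le_trans bv vw.
- by move=> /eqP <-.
move=> D s [D0 dir] [ub lub] Us; apply: contrapT => noDU.
have Dstem x : D x -> x <= stem b.
  move=> Dx; have : ~ tail b x by move=> Ux; apply: noDU; exists x.
  case: x Dx => [[w []]|] Dx //=; last first.
    by move=> /negP; rewrite -leNgt.
  (* A tooth in [D] is maximal, so it equals [s], which lies in the tail. *)
  have := ub _ Dx => /eqP ws; rewrite -{}ws in Us *.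
  by [].
have := lub _ Dstem; case: s {ub lub} Us => [[w []]|] //= bw.
  by move=> /eqP.
by move=> wb; have := lt_le_trans bw wb; rewrite ltxx.
Qed.

(** A tooth is never the supremum of a set that omits it: everything strictly below [tooth w] is
    below [stem w], which would be a smaller bound. *)
Lemma scott_open_tooth w : scott_open [set tooth w].
Proof.
split=> [x y -> /eqP <-//|D s [D0 dir] [ub lub] /= sw].
rewrite {}sw in ub lub *; exists (tooth w); split=> //.
apply: contrapT => nDw; have : tooth w <= stem w; last by move=> /eqP.
apply: lub => x Dx; have := ub _ Dx.
case: x Dx => [[v []]|] Dx; [move=> /eqP vw|exact: id|by move=> /eqP].
by case: nDw; rewrite -vw.
Qed.

Lemma MaxE : Max (comb W) = [set x | ~~ is_stem x].
Proof.
apply/seteqP; split=> x /=; last first.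
  by move=> nx y; exact: nstem_maximal.
move=> mx; apply/negP => /is_stemP[w xw].
by have := mx tip; rewrite xw => /(_ isT).
Qed.

End Comb.

(** * The space of maximal points: Hausdorff, but not a k-space *)

Section CombMax.
Context {d : Order.disp_t} (W : orderType d).

Definition comb_max : Type := set_type (Max (comb W)).

HB.instance Definition _ := Topological.on comb_max.

Lemma tip_Max : Max (comb W) tip. Proof. by rewrite MaxE. Qed.

(* [compact_cover] is only available for pointed spaces. *)
HB.instance Definition _ :=
  isPointed.Build comb_max (exist _ tip (mem_set tip_Max)).

Implicit Types (x y : comb_max) (w b : W).

Definition pt x : comb W := set_val x.

Lemma pt_inj : injective pt. Proof. exact: val_inj. Qed.

Lemma ptP x : pt x = tip \/ exists w, pt x = tooth w.
Proof.
have : Max (comb W) (pt x) by exact: set_valP.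
by rewrite MaxE /=; case: (pt x) => [[w []]|] // _; [right; exists w|left].
Qed.

Lemma pt_surj (c : comb W) : ~~ is_stem c -> exists x, pt x = c.
Proof.
move=> nc; have mc : Max (comb W) c by rewrite MaxE.
by exists (exist _ c (mem_set mc)).
Qed.

Lemma open_pt (U : set (comb W)) : scott_open U -> open (pt @^-1` U).
Proof. by move=> oU; exists U. Qed.

Lemma open_pt_singleton x : pt x <> tip -> open [set x].
Proof.
have [->//|[w xw] _] := ptP x.
have -> : [set x] = pt @^-1` [set tooth w].
  by apply/seteqP; split=> [y ->//|y /= yw]; apply: pt_inj; rewrite yw.
exact/open_pt/scott_open_tooth.
Qed.

Lemma comb_max_hausdorff : hausdorff_space comb_max.
Proof.
(* Of two distinct points at least one is a tooth. Its singleton is open, and [tail w] separates it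
   from [tip] because the inequality in [tail] is strict. *)
have sep x y w : pt x = tooth w -> x != y ->
    exists UV : set comb_max * set comb_max,
    [/\ UV.1 x, UV.2 y, open UV.1, open UV.2 & UV.1 `&` UV.2 = set0].
  move=> xw xy; have xtip : pt x <> tip by rewrite xw.
  have [ytip|[v yv]] := ptP y.
    exists ([set x], pt @^-1` tail w); split => //=; rewrite ?ytip//.
    - exact: open_pt_singleton.
    - exact/open_pt/scott_open_tail.
    - by apply/seteqP; split=> // z [->]; rewrite /= xw /= ltxx.
  exists ([set x], [set y]); split => //=; first exact: open_pt_singleton.
    by apply: open_pt_singleton; rewrite yv.
  by apply/seteqP; split=> // z [/= ->] xEy; rewrite xEy eqxx in xy.
rewrite open_hausdorff => x y xy.
have [xtip|[w /sep/(_ xy)[UV [Ux Vy oU oV UV0]]]] := ptP x; last first.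
  by exists UV; rewrite ?inE; split=> //; apply/eqP.
have [ytip|[w yw]] := ptP y.
  by case/eqP: xy; apply: pt_inj; rewrite ytip.
have [|[V U] /= [Vy Ux oV oU VU0]] := sep y x w yw; first by rewrite eq_sym.
by exists (U, V); rewrite ?inE; split=> //=; rewrite setIC.
Qed.

Lemma comb_max_compact_finite (K : set comb_max) :
    countably_bounded W -> compact K ->
  finite_set ([set x | pt x <> tip] `&` K).
Proof.
rewrite compact_cover => countable_ub cK.
apply: contrapT => /infiniteP/card_subP[C Cnat CK].
have [b Cb] : exists b, forall x w, C x -> pt x = tooth w -> w < b.
  have [|b ub] := countable_ub (\bigcup_(x in C) [set w | pt x = tooth w]).
    apply: bigcup_countable => [|x _].
      by rewrite (eq_countable Cnat).
    have [xtip|[v xv]] := ptP x.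
      apply: (sub_countable _ (countable0 W)); apply: subset_card_le => w /=.
      by rewrite xtip.
    apply: (sub_countable _ (countable1 v)); apply: subset_card_le => w /=.
    by rewrite xv => -[].
  by exists b => x w Cx xw; apply: ub; exists x.
(* An open cover in which [tip] gets a neighbourhood that misses [C] and each tooth gets only
   itself: a finite subcover must list every point of [C]. *)
pose f x := if pt x == tip then pt @^-1` tail b else [set x].
have [x _|x _|D _ KD] := cK _ setT f.
- rewrite /f; case: eqP => [_|]; last exact: open_pt_singleton.
  exact/open_pt/scott_open_tail.
- by exists x => //; rewrite /f; case: eqP => // /= ->.
have : finite_set C.
  apply: sub_finite_set (finite_fset D) => x Cx.
  have [xtip Kx] := CK _ Cx; have [y Dy] := KD _ Kx.
  rewrite /f; case: eqP => _ /=; last by move=> ->.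
  have [//|[w xw]] := ptP x.
  by rewrite xw /= => bw; have := lt_trans bw (Cb _ _ Cx xw); rewrite ltxx.
by rewrite (eq_finite_set Cnat); exact: infinite_nat.
Qed.

Lemma comb_max_not_closed :
  countably_bounded W -> ~ closed [set x | pt x <> tip].
Proof.
move=> countable_ub clA; have [p ptip] := @pt_surj tip isT.
apply: (clA p) => // B; rewrite nbhsE => -[_ [[U oU <-] Up] UB].
have tipsup : supremums (range (@stem _ W)) tip.
  split=> [_ [w _ <-]//|[[w c]|]// ub].
  have [b /(_ w erefl)] := countable_ub _ (countable1 w).
  by rewrite ltNge => /negP[]; have := ub (stem b) (ex_intro2 _ _ b I erefl).
have stemdir : directed (range (@stem _ W)).
  split=> [|_ _ [v _ <-] [w _ <-]].
    by have [w _] := countable_ub _ (countable0 W); exists (stem w); exists w.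
  have [vw|/ltW wv] := leP v w; first by exists (stem w); split=> //; exists w.
  by exists (stem v); split=> //; exists v.
have Utip : U tip by rewrite -ptip.
(* The chain enters [U] at some [stem w]; as an upper set, [U] then contains [tooth w]. *)
have [_ [[w _ <-] Uw]] := oU.2 _ _ stemdir tipsup Utip.
have [x xw] := @pt_surj (tooth w) isT.
exists x; split; first by rewrite /= xw.
by apply: UB; rewrite /= -/(pt x) xw; apply: oU.1 Uw _; exact: lexx w.
Qed.

Lemma comb_max_not_k_space : countably_bounded W -> ~ k_space comb_max.
Proof.
move=> countable_ub /(_ [set x | pt x <> tip]) kA.
apply: comb_max_not_closed => //; apply: kA => K cK.
(* It is enough that the trace on [K] is closed in the whole space, where it is a finite set of a
   Hausdorff space. *)
apply: preimage_closed => [x _|]; first exact: initial_continuous.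
have /accessible_finite_set_closed := hausdorff_accessible comb_max_hausdorff.
by apply; exact: comb_max_compact_finite.
Qed.

End CombMax.

Theorem theorem3p8 :
  exists X : topologicalType,
    [/\ hausdorff_space X,
        exists (d : Order.disp_t) (P : porderType d),
          bounded_complete_dcpo_model P X
      & ~ k_space X].
Proof.
exists (comb_max omega1); split; first exact: comb_max_hausdorff.
  exists omega1_display, (comb omega1); split; last first.
    exact: comb_bounded_complete omega1_has_minima.
  split; first exact: comb_dcpo omega1_has_minima.
  (* [comb_max] is by definition the subspace of maximal points. *)
  by exists id, id; split=> // x; exact: cvg_id.
exact: comb_max_not_k_space omega1_countably_bounded.
Qed.
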